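(* Let $M$ be a multicubic implication algebra and let $\Delta$ be a Delta-operator on $M$. Let $\mathcal N(M)$ be the set of nowhere invariant elements of $M$ and let $\Phi(1)=\{x\in M : \Delta(1,x)=x\}$. Then there is an embedding (of implication algebras) $$e\colon M\to \mathcal N(M)\times\Phi(1)$$ whose image is upwards closed.
   Context: An implication algebra is a set with a binary operation $\to$ satisfying $(x\to y)\to x=x$, $(x\to y)\to y=(y\to x)\to x$, $x\to(y\to z)=y\to(x\to z)$. Put $1=x\to x$, $x\le y$ iff $x\to y=1$, and $x\vee y=(x\to y)\to y$ (the join). Each interval $[a,1]$ is a Boolean algebra in which the complement of $b\ge a$ is $b\to a$; $\wedge$ denotes greatest lower bounds, when they exist. For a Boolean algebra $B$, $\mathscr I(B)=\{[a,b]: a\le b \text{ in } B\}$ is ordered by inclusion, with top $1=[0,1]$, $[a,b]\vee[c,d]=[a\wedge c,b\vee d]$, partial operation $\Delta([a,b],[c,d])=[a\vee(b\wedge\overline d),\,b\wedge(a\vee\overline c)]$ for $[c,d]\le[a,b]$, and implication $x\to y=\Delta(1,\Delta(x\vee y,y))\vee y$. A multicubic implication algebra is an implication algebra isomorphic to an upwards-closed subalgebra of $B\times\mathscr I(B)$ for some Boolean algebra $B$, where $\Delta$ on the product acts as usual on $\mathscr I(B)$ and as the identity on $B$ (i.e. $\Delta(b,a)=a$ there). A Delta-operator on a multicubic implication algebra $M$ is a partial binary function $\Delta$ on $M$ such that: (a) $\Delta(b,a)$ is defined and $\le b$ whenever $a\le b$; (b) $\Delta(a,a)=a$; (c) if $a\le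 b$ then $\Delta(b,\Delta(b,a))=a$; (d) if $a\le b\le c$ then $\Delta(c,a)\le\Delta(c,b)$; (e) if $a\le b\le c$ then $\Delta(c,\Delta(b,a))=\Delta(\Delta(c,b),\Delta(c,a))$; (f) if $a<b$ then either $\Delta(b,a)=a$, or $\Delta(b,a)$ and $a$ have no common lower bound; (g) if $a\le b$ then $\Delta(b,a)=b\wedge\Delta(1,b\to a)$. An element $u\in M$ is somewhere invariant if there is $v>u$ with $\Delta(v,u)=u$; otherwise it is nowhere invariant. $\mathcal N(M)$ and $\Phi(1)$ are upwards closed in $M$ and carry the order and implication inherited from $M$; the product carries the componentwise structure. *)

(* Defs.v *)
From mathcomp Require Import all_boot order.
From mathcomp Require Import boolp classical_sets.

Set Implicit Arguments.
Unset Strict Implicit.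
Unset Printing Implicit Defensive.

Import Order.Theory.

(* The field [impxx] makes the constant [one] the element x -> x, which by the
   three axioms does not depend on x; its presence excludes the empty algebra. *)
Record implAlg := ImplAlg {
  ia_sort :> Type;
  imp : ia_sort -> ia_sort -> ia_sort;
  one : ia_sort;
  impxx : forall x, imp x x = one;
  imp_absorb : forall x y, imp (imp x y) x = x;
  imp_joinC : forall x y, imp (imp x y) y = imp (imp y x) x;
  imp_exch : forall x y z, imp x (imp y z) = imp y (imp x z) }.

Arguments one {i}.

Declare Scope impl_scope.
Delimit Scope impl_scope with I.
Local Open Scope impl_scope.

Notation "x ~> y" := (imp x y) (at level 55, right associativity) : impl_scope.

Definition ile (M : implAlg) (x y : M) : Prop := x ~> y = one.
Definition ilt (M : implAlg) (x y : M) : Prop := ile x y /\ x <> y.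

Definition is_glb (M : implAlg) (x y m : M) : Prop :=
  [/\ ile m x, ile m y & forall z, ile z x -> ile z y -> ile z m].

Definition upclosed (M : implAlg) (U : set M) : Prop :=
  forall x y, U x -> ile x y -> U y.

Definition embedding (A B : implAlg) (e : A -> B) : Prop :=
  injective e /\ forall x y, e (x ~> y) = e x ~> e y.

Section Theory.
Variable M : implAlg.
Implicit Types x y z : M.

Lemma imp1x x : one ~> x = x.
Proof. by rewrite -(impxx x) imp_absorb. Qed.

Lemma impx1 x : x ~> one = one.
Proof. by rewrite -{1}(imp1x x) imp_absorb. Qed.

Lemma ile_refl x : ile x x.
Proof. exact: impxx. Qed.

Lemma ilex1 x : ile x one.
Proof. exact: impx1. Qed.

Lemma ile_imp x y : ile y (x ~> y).
Proof. by rewrite /ile imp_exch impxx impx1. Qed.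

Lemma ile_anti x y : ile x y -> ile y x -> x = y.
Proof.
rewrite /ile => xy yx.
by rewrite -[RHS]imp1x -{1}xy imp_joinC yx imp1x.
Qed.

Lemma ile_trans y x z : ile x y -> ile y z -> ile x z.
Proof.
rewrite /ile => xy yz.
by rewrite -[z]imp1x -yz imp_joinC imp_exch xy impx1.
Qed.

Lemma imp_homo x y z : ile y z -> ile (x ~> y) (x ~> z).
Proof.
move=> yz; suff -> : x ~> z = (z ~> y) ~> x ~> y by exact: ile_imp.
by rewrite imp_exch -imp_joinC yz imp1x.
Qed.

Lemma imp_anti x y z : ile x y -> ile (y ~> z) (x ~> z).
Proof.
move=> xy; rewrite /ile imp_exch; apply: ile_trans xy _.
by rewrite /ile imp_exch impxx.
Qed.

Lemma imp_contr x y : x ~> x ~> y = x ~> y.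
Proof. by rewrite -{1}[x](imp_absorb x y) imp_absorb. Qed.

Lemma imp_mp (p r u : M) : ile p r -> ile p (r ~> u) -> ile p u.
Proof.
move=> pr pru; rewrite /ile -imp_contr.
exact: ile_trans pru (imp_anti _ pr).
Qed.

End Theory.

Definition prod_implAlg (A B : implAlg) : implAlg.
Proof.
refine (@ImplAlg (A * B)%type (fun p q => (p.1 ~> q.1, p.2 ~> q.2)) (one, one)
  _ _ _ _).
- by move=> [a b] /=; rewrite !impxx.
- by move=> [a b] [c d] /=; rewrite !imp_absorb.
- by move=> [a b] [c d] /=; congr pair; apply: imp_joinC.
- by move=> [a b] [c d] [e f] /=; congr pair; apply: imp_exch.
Defined.

Definition up_imp (M : implAlg) (U : set M) (upU : upclosed U) (x y : U) : U :=
  SigSub (mem_set (upU _ _ (set_valP y) (ile_imp (val x) (val y)))).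

Definition up_implAlg (M : implAlg) (U : set M) (upU : upclosed U)
  (U1 : U one) : implAlg.
Proof.
refine (@ImplAlg U (up_imp upU) (SigSub (mem_set U1)) _ _ _ _).
- by move=> x; apply: val_inj; rewrite /= impxx.
- by move=> x y; apply: val_inj; rewrite /= imp_absorb.
- by move=> x y; apply: val_inj; rewrite /= imp_joinC.
- by move=> x y z; apply: val_inj; rewrite /= imp_exch.
Defined.

Section BooleanAlgebra.
Local Open Scope order_scope.
Context {d : Order.disp_t} (B : ctbDistrLatticeType d).

Definition bool_implAlg : implAlg.
Proof.
refine (@ImplAlg B (fun x y => ~` x `|` y) \top _ _ _ _).
- by move=> x; rewrite joinC joinxC.
- by move=> x y; rewrite complU complK joinC meetKU.
- move=> x y; rewrite !complU !complK !joinIl.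
  by rewrite ![~` _ `|` _]joinC !joinxC !meetx1 joinC.
- by move=> x y z; rewrite joinCA.
Defined.

Record itv := Itv { lo : B; hi : B; itvP : lo <= hi }.

Lemma itv_inj (x y : itv) : lo x = lo y -> hi x = hi y -> x = y.
Proof.
case: x y => [a b ab] [c e ce] /= ac be; subst c e.
by rewrite (bool_irrelevance ab ce).
Qed.

Lemma itv_top_subproof : (\bot : B) <= \top.
Proof. exact: le0x. Qed.

Definition itv_top : itv := Itv itv_top_subproof.

Lemma itv_join_subproof (x y : itv) : lo x `&` lo y <= hi x `|` hi y.
Proof.
exact: le_trans (leIl _ _) (le_trans (itvP x) (leUl _ _)).
Qed.

Definition itv_join (x y : itv) : itv := Itv (itv_join_subproof x y).

Lemma itv_delta_subproof (x y : itv) :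
  lo x `|` (hi x `&` ~` hi y) <= hi x `&` (lo x `|` ~` lo y).
Proof.
rewrite leUx !lexI itvP leUl leIl /=.
by rewrite (le_trans (leIr _ _)) // (le_trans _ (leUr _ _)) // leC itvP.
Qed.

(* The formula gives an interval for all x and y; it is only meaningful, and
   only used below, when y is contained in x. *)
Definition itv_delta (x y : itv) : itv := Itv (itv_delta_subproof x y).

Definition itv_imp (x y : itv) : itv :=
  itv_join (itv_delta itv_top (itv_delta (itv_join x y) y)) y.

Lemma itv_disj (x : itv) : lo x `&` ~` hi x = \bot.
Proof. by apply/eqP; rewrite disj_leC complK itvP. Qed.

Lemma lo_imp x y : lo (itv_imp x y) = lo y `&` ~` lo x.
Proof.
rewrite /= join0x meet1x complI !complU complK complI meetUl -meetA.
rewrite [~` hi y `&` _]meetC itv_disj meetx0 join0x -meetA meetxx meetUl.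
by rewrite [~` lo y `&` _]meetC meetxC joinx0 meetC.
Qed.

Lemma hi_imp x y : hi (itv_imp x y) = hi y `|` ~` hi x.
Proof.
rewrite /= meet1x join0x complU !complI complK complU joinIl.
rewrite -[X in _ `&` X]joinA joinxx [X in _ `&` X]joinIl.
rewrite [~` hi y `|` _]joinC joinxC meetx1 [RHS]joinC.
by apply: meet_r; rewrite leU2 // (le_trans _ (leUl _ _)) // leC itvP.
Qed.

Definition itv_implAlg : implAlg.
Proof.
refine (@ImplAlg itv itv_imp itv_top _ _ _ _).
- by move=> x; apply: itv_inj; rewrite ?lo_imp ?hi_imp ?meetxC ?joinxC.
- move=> x y; apply: itv_inj; rewrite ?lo_imp ?hi_imp.
    by rewrite complI complK joinC joinKI.
  by rewrite complU complK meetC meetKU.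
- move=> x y; apply: itv_inj; rewrite !(lo_imp, hi_imp).
    by rewrite !complI !complK !meetUr !meetxC !join0x meetC.
  by rewrite !complU !complK !joinIr !joinxC !meet1x joinC.
- move=> x y z; apply: itv_inj; rewrite !(lo_imp, hi_imp).
    by rewrite meetAC.
  by rewrite joinAC.
Defined.

Lemma itv_ileP (x y : itv_implAlg) :
  ile x y <-> (lo y <= lo x) && (hi x <= hi y).
Proof.
have lo1 : (lo y `&` ~` lo x == \bot) = (lo y <= lo x).
  by rewrite disj_leC complK.
have hi1 : (hi y `|` ~` hi x == \top) = (hi x <= hi y).
  rewrite -(inj_eq (@compl_inj _ B)) complU complK compl1 meetC.
  by rewrite disj_leC complK.
rewrite -lo1 -hi1 -lo_imp -hi_imp; split.
  by move=> h; rewrite [itv_imp x y]h /= !eqxx.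
by case/andP => /eqP l /eqP h; apply: itv_inj.
Qed.

Definition bool_itv_implAlg : implAlg := prod_implAlg bool_implAlg itv_implAlg.

Definition bool_itv_delta (p q : bool_itv_implAlg) : bool_itv_implAlg :=
  (q.1, itv_delta p.2 q.2).

End BooleanAlgebra.

Definition multicubic (M : implAlg) : Prop :=
  exists (d : Order.disp_t) (B : ctbDistrLatticeType d)
         (phi : M -> bool_itv_implAlg B),
    [/\ embedding phi,
        upclosed (range phi)
      & forall p q, range phi p -> range phi q -> ile q p ->
          range phi (bool_itv_delta p q)].

(* A partial binary function is an option-valued one; [D b a] is Delta(b,a). *)
Record delta_operator (M : implAlg) (D : M -> M -> option M) : Prop := {
  delta_def : forall a b, ile a b -> exists2 p, D b a = Some p & ile p b;
  delta_refl : forall a, D a a = Some a;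
  delta_invol : forall a b p, ile a b -> D b a = Some p -> D b p = Some a;
  delta_homo : forall a b c p q, ile a b -> ile b c ->
    D c a = Some p -> D c b = Some q -> ile p q;
  delta_comp : forall a b c p q r, ile a b -> ile b c ->
    D b a = Some p -> D c b = Some q -> D c a = Some r -> D c p = D q r;
  delta_disj : forall a b p, ilt a b -> D b a = Some p ->
    p = a \/ ~ (exists l, ile l p /\ ile l a);
  delta_glb : forall a b p q, ile a b ->
    D b a = Some p -> D one (b ~> a) = Some q -> is_glb b q p }.

Definition somewhere_invariant (M : implAlg) (D : M -> M -> option M) (u : M) :=
  exists2 v, ilt u v & D v u = Some u.

Definition nowhere_invariant (M : implAlg) (D : M -> M -> option M) : set M :=
  [set u | ~ somewhere_invariant D u]%classic.

Definition Phi1 (M : implAlg) (D : M -> M -> option M) : set M :=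
  [set x | D one x = Some x]%classic.

Section DeltaOperator.
Variables (M : implAlg) (D : M -> M -> option M) (hD : delta_operator D).

Lemma nowhere_invariant_up : upclosed (nowhere_invariant D).
Proof.
move=> u w Nu uw [v [wv w_neq_v] Dvw]; apply: Nu.
have [q Dq _] := delta_def hD (ilex1 (v ~> w)).
have [wv' wq glbw] := delta_glb hD wv Dvw Dq.
have uvw : ile u (v ~> w) := ile_trans uw (ile_imp v w).
pose v' := (v ~> w) ~> u.
have uv' : ile u v' := ile_imp _ _.
have v'u : v' ~> u = v ~> w by rewrite /v' imp_joinC uvw imp1x.
have v'v : ile v' v.
  have := imp_homo (v ~> w) (ile_trans uw wv).
  by rewrite imp_absorb.
have [p Dp _] := delta_def hD uv'.
have Dq' : D one (v' ~> u) = Some q by rewrite v'u.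
have [pv' pq glbp] := delta_glb hD uv' Dp Dq'.
exists v'.
  split=> // uE; apply: w_neq_v; apply: ile_anti wv _.
  by rewrite /ile -v'u -uE impxx.
rewrite Dp; congr Some; apply: ile_anti (glbp _ uv' (ile_trans uw wq)).
have pw := glbw _ (ile_trans pv' v'v) pq.
exact: imp_mp (ile_trans pw (ile_imp v w)) pv'.
Qed.

Lemma nowhere_invariant1 : nowhere_invariant D one.
Proof. by move=> [v [v1 v_neq1] _]; apply: v_neq1; rewrite -v1 imp1x. Qed.

Lemma Phi1_up : upclosed (Phi1 D).
Proof.
move=> x y Dx xy; rewrite /Phi1 /=.
have [->|y_neq1] := pselect (y = one); first exact: delta_refl hD one.
have [q Dq _] := delta_def hD (ilex1 y).
have y1 : ilt y one by split=> //; apply: ilex1.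
have [qy|[]] := delta_disj hD y1 Dq; first by rewrite Dq qy.
by exists x; split=> //; exact: (delta_homo hD xy (ilex1 y) Dx Dq).
Qed.

Lemma Phi1_1 : Phi1 D one.
Proof. exact: delta_refl hD one. Qed.

Definition nowhere_implAlg : implAlg :=
  up_implAlg nowhere_invariant_up nowhere_invariant1.

Definition Phi1_implAlg : implAlg := up_implAlg Phi1_up Phi1_1.

End DeltaOperator.

(* Main.v *)
From mathcomp Require Import all_boot classical_sets.
Require Import Defs.

(** Write sigma for Delta(1, -), an order-preserving involution of M whose
    fixed points form the up-closed set Phi(1).

    Every x has a least fixed point above it, the join of x and sigma x.  By
    [delta_disj] and [delta_glb], an element is nowhere invariant exactly when
    1 is the only fixed point above it.  Hence a fixed point f and a nowhere invariant t
    always join to 1, that is, f ~> t = t and t ~> f = f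
    ([fixed_nowhere_imp]).  If p is the least fixed point above x, it follows
    that p ~> x, the complement of p in [x, 1], is the least nowhere invariant
    element above x.

    So both Phi(1) and the set of nowhere invariant elements are up-closed and
    contain a least element above each x.  Sending x to that least element is
    a homomorphism for any such set ([least_above_imp]), and the two
    homomorphisms together are the embedding.  It is injective because x is the
    meet of p and p ~> x.  Its image is up-closed because a pair (t, f) above
    the image of x is the image of the meet of t and f in the Boolean algebra
    [x, 1]: orthogonality of t and f recovers each from this meet. *)

Set Implicit Arguments.
Unset Strict Implicit.
Unset Printing Implicit Defensive.

Local Open Scope impl_scope.

Section ImplicationAlgebra.
Variable M : implAlg.
Implicit Types (x y z a b f t : M) (U : set M).

Lemma ile_joinl x y : ile x ((x ~> y) ~> y).
Proof. by rewrite imp_joinC; apply: ile_imp. Qed.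

Lemma ile_joinr x y : ile y ((x ~> y) ~> y).
Proof. exact: ile_imp. Qed.

Lemma join_lub x y z : ile x z -> ile y z -> ile ((x ~> y) ~> y) z.
Proof.
move=> xz yz; have := imp_anti y (imp_anti y xz).
by rewrite [(z ~> y) ~> y]imp_joinC [y ~> z]yz imp1x.
Qed.

(** The hypothesis says that the join of [f] and [t] is 1; in a Boolean
    interval, [f ~> t] is the join of [t] and the complement of [f]. *)
Lemma imp_join1 f t : (f ~> t) ~> t = one -> f ~> t = t.
Proof. by move=> ft1; apply: ile_anti ft1 (ile_imp f t). Qed.

(** The element [z] is the meet of [a] and [b] in the Boolean algebra
    [[x, 1]], that is, the complement of [a ~> b ~> x]. *)
Lemma meet_above x a b : ile x a -> ile x b ->
  exists z, [/\ ile z a, ile z b, ile a (b ~> z) & ile b (a ~> z)].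
Proof.
have below u v : ile x u -> ile ((u ~> v ~> x) ~> x) u.
  move=> xu; have := imp_anti x (imp_homo u (ile_imp v x)).
  by rewrite [(u ~> x) ~> x]imp_joinC [x ~> u]xu imp1x.
move=> xa xb; set c := a ~> b ~> x.
have ab : ile a (b ~> c ~> x).
  by rewrite /ile [b ~> c ~> x]imp_exch [a ~> _]imp_exch impxx.
exists (c ~> x); split => //; first exact: below.
  by rewrite /c imp_exch; apply: below.
by rewrite /ile imp_exch.
Qed.

Definition least_above U x m : Prop :=
  [/\ U m, ile x m & forall u, U u -> ile x u -> ile m u].

(** For [u] in an up-closed [U], the join of [x] and [u] lies in [U], hence
    above the least element [r x]; so [x ~> u] and [r x ~> u] agree. *)
Lemma imp_least_above U x m u :
  upclosed U -> least_above U x m -> U u -> m ~> u = x ~> u.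
Proof.
move=> upU [_ xm lm] Uu; apply: ile_anti; first exact: imp_anti.
rewrite /ile imp_exch; apply: lm; last exact: ile_joinl.
exact: upU Uu (ile_joinr x u).
Qed.

Lemma least_above_imp U (r : M -> M) :
  upclosed U -> (forall x, least_above U x (r x)) ->
  forall x y, r (x ~> y) = r x ~> r y.
Proof.
move=> upU rP x y.
have [Uy yry ly] := rP y; have [Uxy xyr lxy] := rP (x ~> y).
rewrite (imp_least_above upU (rP x) Uy); apply: ile_anti.
  by apply: lxy; [apply: upU Uy (ile_imp _ _) | apply: imp_homo].
(* [x] and [x ~> y] join to 1, hence so do [x] and [r (x ~> y)]. *)
have <- : x ~> r (x ~> y) = r (x ~> y).
  apply: imp_join1.
  have x_xy : (x ~> x ~> y) ~> x ~> y = one by rewrite imp_contr impxx.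
  apply: ile_anti (ilex1 _) _; rewrite -{1}x_xy.
  apply: join_lub; first exact: ile_joinl.
  exact: ile_trans xyr (ile_joinr _ _).
apply: imp_homo; apply: ly => //.
exact: ile_trans (ile_imp x y) xyr.
Qed.

End ImplicationAlgebra.

Section Decomposition.
Variables (M : implAlg) (D : M -> M -> option M) (hD : delta_operator D).
Implicit Types x y f t v w : M.

(** The default value is never taken, by [sigmaE]. *)
Definition sigma x : M := odflt x (D one x).

Lemma sigmaE x : D one x = Some (sigma x).
Proof. by have [p Dp _] := delta_def hD (ilex1 x); rewrite /sigma Dp. Qed.

Lemma sigmaK x : sigma (sigma x) = x.
Proof. by have := delta_invol hD (ilex1 x) (sigmaE x); rewrite sigmaE => -[]. Qed.

Lemma sigma_homo x y : ile x y -> ile (sigma x) (sigma y).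
Proof.
by move=> xy; apply: (delta_homo hD xy (ilex1 y)); apply: sigmaE.
Qed.

Lemma Phi1P f : Phi1 D f <-> sigma f = f.
Proof. by rewrite /Phi1 /= sigmaE; split=> [[]|->]. Qed.

Definition fix_above x : M := (x ~> sigma x) ~> sigma x.

Lemma fix_aboveP x : least_above (Phi1 D) x (fix_above x).
Proof.
have px := ile_joinl x (sigma x); have psx := ile_joinr x (sigma x).
split=> //; last first.
  move=> f /Phi1P fE xf; apply: join_lub => //.
  by rewrite -fE; apply: sigma_homo.
have p_sp : ile (fix_above x) (sigma (fix_above x)).
  apply: join_lub; last exact: sigma_homo px.
  by rewrite -{1}(sigmaK x); apply: sigma_homo psx.
apply/Phi1P/ile_anti => //.
by have := sigma_homo p_sp; rewrite sigmaK.
Qed.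

(** With [v := f ~> t], the complement of [f] in [[t, 1]], [delta_glb] gives
    [D v t] as the meet of [v] and [sigma f = f], which is [t].  So [t] would
    be invariant in [v], unless [v = t], that is, [f = 1]. *)
Lemma nowhere_fixed1 t f :
  nowhere_invariant D t -> Phi1 D f -> ile t f -> f = one.
Proof.
move=> Nt Ff tf; set v := f ~> t.
have tv : ile t v := ile_imp f t.
have vtf : v ~> t = f by rewrite /v imp_joinC [t ~> f]tf imp1x.
have [tE|t_neq_v] := boolp.pselect (t = v).
  by rewrite -vtf -tE impxx.
case: Nt; exists v => //.
have [p Dp _] := delta_def hD tv.
have Dvt : D one (v ~> t) = Some f by rewrite vtf.
have [pv pf glb] := delta_glb hD tv Dp Dvt.
rewrite Dp; congr Some; apply: ile_anti; last exact: glb.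
exact: imp_mp pf pv.
Qed.

(** If [t] is invariant in [v > t], then by [delta_glb] it lies below both
    [v ~> t] and [sigma (v ~> t)], so [delta_disj] makes [v ~> t] a fixed
    point. *)
Lemma fixed1_nowhere t :
  (forall f, Phi1 D f -> ile t f -> f = one) -> nowhere_invariant D t.
Proof.
move=> t1 [v [tv t_neq_v] Dvt].
have [_ tsw _] := delta_glb hD tv Dvt (sigmaE (v ~> t)).
suff vt : v ~> t = one by apply/t_neq_v/(ile_anti tv vt).
have [//|w_neq1] := boolp.pselect (v ~> t = one).
have tw : ile t (v ~> t) := ile_imp v t.
have w1 : ilt (v ~> t) one by split=> //; apply: ilex1.
apply: (t1 _ _ tw); apply/Phi1P.
by have [//|[]] := delta_disj hD w1 (sigmaE _); exists t.
Qed.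

(** The join of [f] and [t] is above both, so it is fixed as [f] is and 1 by
    [nowhere_fixed1]. *)
Lemma fixed_nowhere_imp f t :
  Phi1 D f -> nowhere_invariant D t -> f ~> t = t /\ t ~> f = f.
Proof.
move=> Ff Nt.
have ft1 : (f ~> t) ~> t = one.
  apply: nowhere_fixed1 Nt _ (ile_joinr f t).
  exact: Phi1_up hD _ _ Ff (ile_joinl f t).
by split; apply: imp_join1 => //; rewrite imp_joinC.
Qed.

Definition nowhere_above x : M := fix_above x ~> x.

Lemma nowhere_aboveP x :
  least_above (nowhere_invariant D) x (nowhere_above x).
Proof.
have [Fp xp lp] := fix_aboveP x; split; first 1 last.
- exact: ile_imp.
- move=> t Nt xt; rewrite -(fixed_nowhere_imp Fp Nt).1; exact: imp_homo.
(* A fixed point [f] above [p ~> x] is above [x], hence above [p], so that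
   [f ~> x <= p ~> x <= f]; absorption then gives [f = 1]. *)
apply: fixed1_nowhere => f Ff nf.
have pf : ile (fix_above x) f.
  by apply: lp => //; apply: ile_trans nf; apply: ile_imp.
by rewrite -[LHS](imp_absorb f x); apply: ile_trans (imp_anti x pf) nf.
Qed.

End Decomposition.

Theorem theorem4p35 (M : implAlg) (hM : multicubic M)
    (D : M -> M -> option M) (hD : delta_operator D) :
  exists e : M -> prod_implAlg (nowhere_implAlg hD) (Phi1_implAlg hD),
    embedding e /\ upclosed (range e).
Proof.
pose n x : nowhere_implAlg hD :=
  SigSub (mem_set (let: And3 Nn _ _ := nowhere_aboveP hD x in Nn)).
pose p x : Phi1_implAlg hD :=
  SigSub (mem_set (let: And3 Fp _ _ := fix_aboveP hD x in Fp)).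
exists (fun x => (n x, p x)); split; first split.
- have le x y : n x = n y -> p x = p y -> ile x y.
    move=> /(congr1 val) /= nE /(congr1 val) /= pE.
    have [[_ xn _] [_ xp _]] := (nowhere_aboveP hD x, fix_aboveP hD x).
    by apply: (@imp_mp _ _ (fix_above D y)); [rewrite -pE | rewrite nE in xn].
  move=> x y exy; have [nE pE] := (congr1 fst exy, congr1 snd exy).
  by apply: ile_anti; apply: le.
- move=> x y; congr pair; apply: val_inj => /=.
    exact: least_above_imp (nowhere_invariant_up hD) (nowhere_aboveP hD) x y.
  exact: least_above_imp (Phi1_up hD) (fix_aboveP hD) x y.
move=> _ [t f] [x _ <-] le_tf.
have nt : ile (nowhere_above D x) (val t) := congr1 (fun q => val q.1) le_tf.
have pf : ile (fix_above D x) (val f) := congr1 (fun q => val q.2) le_tf.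
have Nt : nowhere_invariant D (val t) := set_valP t.
have Ff : Phi1 D (val f) := set_valP f.
have [_ xn _] := nowhere_aboveP hD x; have [_ xp _] := fix_aboveP hD x.
have [z [zt zf tfz ftz]] :=
  meet_above (ile_trans xn nt) (ile_trans xp pf).
have [Nn zn ln] := nowhere_aboveP hD z; have [Fp zp lp] := fix_aboveP hD z.
(* [t <= f ~> z <= f ~> n z = n z] by orthogonality of [f] and [n z], and
   symmetrically [f <= p z]. *)
exists z => //; congr pair; apply: val_inj => /=; apply: ile_anti.
- exact: ln.
- by rewrite -(fixed_nowhere_imp hD Ff Nn).1; apply: ile_trans tfz (imp_homo _ zn).
- exact: lp.
by rewrite -(fixed_nowhere_imp hD Fp Nt).2; apply: ile_trans ftz (imp_homo _ zp).
Qed.
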